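(* Let $R=\mathbb{C}[\partial]x\oplus\mathbb{C}[\partial]y$ be the free $\mathbb{Z}_2$-graded $\mathbb{C}[\partial]$-module with $R_{\bar0}=\mathbb{C}[\partial]x$, $R_{\bar1}=\mathbb{C}[\partial]y$, equipped with one of the following five Lie conformal superalgebra structures: $R_1$: $[x_\lambda x]=0$, $[x_\lambda y]=0$, $[y_\lambda y]=p(\partial)x$, with $p(\partial)\in\mathbb{C}[\partial]$; $R_2$: $[x_\lambda x]=0$, $[y_\lambda y]=0$, $[x_\lambda y]=q(\lambda)y$, with $q(\lambda)\in\mathbb{C}[\lambda]$; $R_3$: $[x_\lambda x]=(\partial+2\lambda)x$, $[x_\lambda y]=0$, $[y_\lambda y]=0$; $R_4$: $[x_\lambda x]=(\partial+2\lambda)x$, $[x_\lambda y]=(\partial+\beta\lambda+\gamma)y$, $[y_\lambda y]=0$, with $\beta,\gamma\in\mathbb{C}$; $R_5$: $[x_\lambda x]=(\partial+2\lambda)x$, $[x_\lambda y]=(\partial+\tfrac32\lambda)y$, $[y_\lambda y]=\alpha x$, with $\alpha\in\mathbb{C}$. Let $\circ_\lambda$ be an even $\lambda$-product on $R$. Then $\circ_\lambda$ defines a compatible transposed Poisson conformal superalgebra (TPCSA) structure on $R$ if and only if it is one of the following (where in each explicit list the remaining product is given by commutativity, $y\circ_\lambda x=x\circ_{-\partial-\lambda}y$): (1) For $R_1$: if $p(\partial)\neq0$, then $x\circ_\lambda x=0$, $x\circ_\lambda y=0$, and $y\circ_\lambda y=(\partial+2\lambda)\Phi\bigl(\partial,(\partial+2\lambda)^2\bigr)x$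 with $\Phi(s,t)\in\mathbb{C}[s,t]$ (each polynomial $\Phi\in\mathbb{C}[s,t]$ defines such a structure). If $p(\partial)=0$, then $R_1$ is abelian, and every even commutative associative $\lambda$-product gives such a structure. (2) For $R_2$: if $q(\lambda)=0$, then $R_2$ is abelian, and every even commutative associative $\lambda$-product gives such a structure. If $q(\lambda)$ is a nonzero constant, then $x\circ_\lambda x=cx$, $x\circ_\lambda y=cy$, $y\circ_\lambda y=0$, with $c\in\mathbb{C}$. If $q(\lambda)$ is nonconstant, then only the trivial structure exists: $x\circ_\lambda x=x\circ_\lambda y=y\circ_\lambda y=0$. (3) For $R_3$: every structure is given by $x\circ_\lambda x=cx$, $x\circ_\lambda y=0$, $y\circ_\lambda y=0$, with $c\in\mathbb{C}$. (4) For $R_4$: if $\beta=2$, then $x\circ_\lambda x=cx$, $x\circ_\lambda y=cy$, $y\circ_\lambda y=0$, with $c\in\mathbb{C}$. If $\beta\neq2$, then only the trivial structure exists: $x\circ_\lambda x=x\circ_\lambda y=y\circ_\lambda y=0$. (5) For $R_5$: only the trivial structure exists: $x\circ_\lambda x=x\circ_\lambda y=y\circ_\lambda y=0$.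
   Context: All vector spaces and linear maps are over $\mathbb{C}$. A $\mathbb{Z}_2$-graded $\mathbb{C}[\partial]$-module is a $\mathbb{C}[\partial]$-module $A=A_{\bar0}\oplus A_{\bar1}$ with $\partial A_i\subseteq A_i$; $|a|$ denotes the parity of a homogeneous element $a$. Whenever $|a|$ occurs, $a$ is assumed homogeneous, and the formula is extended by linearity. $A[\lambda]$ denotes polynomials in $\lambda$ with coefficients in $A$. An even $\lambda$-product on $A$ is a $\mathbb{C}$-bilinear map $A\otimes A\to A[\lambda]$, $a\otimes b\mapsto a\circ_\lambda b$, with $A_i\circ_\lambda A_j\subseteq A_{i+j}[\lambda]$, satisfying sesquilinearity: $(\partial a)\circ_\lambda b=-\lambda\, a\circ_\lambda b$, $a\circ_\lambda(\partial b)=(\partial+\lambda)(a\circ_\lambda b)$; then $(A,\circ_\lambda)$ is called a conformal superalgebra. Such a product on a free module is determined by its values on generators. Substitution convention: if $a\circ_\lambda b=\sum_n\lambda^n c_n$, then $a\circ_{-\partial-\lambda}b=\sum_n(-\partial-\lambda)^nc_n$ with $\partial$ acting on the coefficients $c_n$, and similarly for brackets. The product is commutative if $a\circ_\lambda b=(-1)^{|a||b|}b\circ_{-\partial-\lambda}a$, and associative if $a\circ_\lambda(b\circ_\mu c)=(a\circ_\lambda b)\circ_{\lambda+\mu}c$, for all $a,b,c$. A Lie conformal superalgebra $(A,[\cdot_\lambda\cdot])$ is a $\mathbb{Z}_2$-graded $\mathbb{C}[\partial]$-module with a $\mathbb{C}$-bilinear map $a\otimes b\mapsto[a_\lambda b]\in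 A[\lambda]$, $[{A_i}_\lambda A_j]\subseteq A_{i+j}[\lambda]$, such that $[(\partial a)_\lambda b]=-\lambda[a_\lambda b]$, $[a_\lambda(\partial b)]=(\partial+\lambda)[a_\lambda b]$, $[a_\lambda b]=-(-1)^{|a||b|}[b_{-\lambda-\partial}a]$, and $[a_\lambda[b_\mu c]]=[[a_\lambda b]_{\lambda+\mu}c]+(-1)^{|a||b|}[b_\mu[a_\lambda c]]$. For each $R_i$, the bracket $[y_\lambda x]$ is determined by skew-symmetry. Abelian means the bracket is identically zero. A transposed Poisson conformal superalgebra (TPCSA) is a $\mathbb{Z}_2$-graded $\mathbb{C}[\partial]$-module $\mathcal{L}$ with $\circ_\lambda$ and $[\cdot_\lambda\cdot]$ such that $(\mathcal{L},\circ_\lambda)$ is a commutative associative conformal superalgebra, $(\mathcal{L},[\cdot_\lambda\cdot])$ is a Lie conformal superalgebra, and $2(a\circ_\lambda[b_\mu c])=[(a\circ_\lambda b)_{\lambda+\mu}c]+(-1)^{|a||b|}[b_\mu(a\circ_\lambda c)]$ for all $a,b,c\in\mathcal{L}$. A compatible TPCSA structure on a Lie conformal superalgebra $(A,[\cdot_\lambda\cdot])$ is an even $\lambda$-product $\circ_\lambda$ on $A$ such that $(A,\circ_\lambda,[\cdot_\lambda\cdot])$ is a TPCSA. *)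

(* Defs.v *)
From HB Require Import structures.
From mathcomp Require Import all_boot all_order all_algebra.
From mathcomp Require Import boolp reals.
From mathcomp Require Import complex.
Set Implicit Arguments.
Unset Strict Implicit.
Unset Printing Implicit Defensive.
Import GRing.Theory.
Local Open Scope ring_scope.

(* lpoly M is M[t], polynomials in one variable with coefficients in a module
   M: finitely supported sequences of coefficients.  If M is a K-module, then
   M[t] is a K[t]-module.  With K = C[d], the type lpoly A is A[lambda], a
   module over C[d][lambda], and lpoly (lpoly A) is A[lambda][mu]. *)
Record lpoly (M : zmodType) := LPoly {
  lcoef :> nat -> M;
  lcoefP : exists N, forall n, (N <= n)%N -> lcoef n = 0 }.

Section LPolyZmod.
Variable M : zmodType.
Implicit Types u v w : lpoly M.

Lemma lpolyP u v : (forall n, u n = v n) -> u = v.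
Proof.
case: u v => [u Pu] [v Pv] /= /funext E; rewrite -{v}E in Pv *.
by rewrite (Prop_irrelevance Pu Pv).
Qed.

HB.instance Definition _ := gen_eqMixin (lpoly M).
HB.instance Definition _ := gen_choiceMixin (lpoly M).

Fact lpoly0_subproof :
  exists N, forall n, (N <= n)%N -> (fun=> 0 : M) n = 0.
Proof. by exists 0%N. Qed.
Definition lpoly0 := LPoly lpoly0_subproof.

Fact lpolyN_subproof u :
  exists N, forall n, (N <= n)%N -> (fun n => - u n) n = 0.
Proof. by have [N uN] := lcoefP u; exists N => n /uN ->; rewrite oppr0. Qed.
Definition lpolyN u := LPoly (lpolyN_subproof u).

Fact lpolyD_subproof u v :
  exists N, forall n, (N <= n)%N -> (fun n => u n + v n) n = 0.
Proof.
have [[N uN] [N' vN]] := (lcoefP u, lcoefP v).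
by exists (maxn N N') => n; rewrite geq_max => /andP[/uN -> /vN ->]; rewrite addr0.
Qed.
Definition lpolyD u v := LPoly (lpolyD_subproof u v).

Fact lpolyDA : associative lpolyD.
Proof. by move=> u v w; apply: lpolyP => n /=; rewrite addrA. Qed.
Fact lpolyDC : commutative lpolyD.
Proof. by move=> u v; apply: lpolyP => n /=; rewrite addrC. Qed.
Fact lpolyD0 : left_id lpoly0 lpolyD.
Proof. by move=> u; apply: lpolyP => n /=; rewrite add0r. Qed.
Fact lpolyDN : left_inverse lpoly0 lpolyN lpolyD.
Proof. by move=> u; apply: lpolyP => n /=; rewrite addNr. Qed.

HB.instance Definition _ :=
  GRing.isZmodule.Build (lpoly M) lpolyDA lpolyDC lpolyD0 lpolyDN.

Fact lconst_subproof (a : M) : exists N, forall n, (N <= n)%N ->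
  (fun n => if n == 0%N then a else 0) n = 0.
Proof. by exists 1%N => -[]. Qed.

Definition lconst (a : M) : lpoly M := LPoly (lconst_subproof a).

(* A bound on the support (not necessarily the least one). *)
Definition lsize u : nat := projT1 (cid (lcoefP u)).

Lemma lsizeP u n : (lsize u <= n)%N -> u n = 0.
Proof. exact: (projT2 (cid (lcoefP u))). Qed.

End LPolyZmod.

Section LPolyLmod.
Variables (K : nzRingType) (M : lmodType K).
Implicit Types (p q : {poly K}) (u v : lpoly M).

Fact lpolyZ_subproof p u : exists N, forall n, (N <= n)%N ->
  (fun n => \sum_(i < n.+1) p`_i *: u (n - i)%N) n = 0.
Proof.
exists (size p + lsize u)%N => n le_n; rewrite big1 // => i _.
have [le_p|lt_p] := leqP (size p) i; first by rewrite nth_default ?scale0r.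
rewrite lsizeP ?scaler0 // leq_subRL -1?ltnS //.
by apply: leq_trans le_n; rewrite leq_add2r ltnW.
Qed.

Definition lpolyZ p u := LPoly (lpolyZ_subproof p u).

Fact lpolyZE p u n : lpolyZ p u n = \sum_(i < n.+1) p`_i *: u (n - i)%N.
Proof. by []. Qed.

Fact lpolyZ_rev p u n :
  lpolyZ p u n = \sum_(i < n.+1) p`_(n - i) *: u i.
Proof.
rewrite /= (reindex_inj rev_ord_inj) /=.
by apply: eq_bigr => j _; rewrite (sub_ordK j).
Qed.

Fact lpolyZA p q u : lpolyZ p (lpolyZ q u) = lpolyZ (p * q) u.
Proof.
apply: lpolyP => i; rewrite lpolyZE lpolyZ_rev.
pose coef3 j k := p`_j *: (q`_(i - j - k) *: u k).
transitivity (\sum_(j < i.+1) \sum_(k < i.+1 | (k <= i - j)%N) coef3 j k).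
  apply: eq_bigr => j _; rewrite lpolyZ_rev scaler_sumr.
  by rewrite (big_ord_narrow_leq (leq_subr _ _)).
rewrite (exchange_big_dep predT) //=; apply: eq_bigr => k _.
transitivity (\sum_(j < i.+1 | (j <= i - k)%N) coef3 j k).
  apply: eq_bigl => j; rewrite -ltnS -(ltnS j) -!subSn ?leq_ord //.
  by rewrite -subn_gt0 -(subn_gt0 j) -!subnDA addnC.
rewrite (big_ord_narrow_leq (leq_subr _ _)) coefM scaler_suml.
by apply: eq_bigr => j _; rewrite /coef3 -!subnDA addnC scalerA.
Qed.

Fact lpoly1Z : left_id 1 lpolyZ.
Proof.
move=> u; apply: lpolyP => n /=; rewrite big_ord_recl subn0 coef1 scale1r.
by rewrite big1 ?addr0 // => i _; rewrite coef1 scale0r.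
Qed.

Fact lpolyZDr : right_distributive lpolyZ +%R.
Proof.
move=> p u v; apply: lpolyP => n /=; rewrite -big_split /=.
by apply: eq_bigr => i _; rewrite scalerDr.
Qed.

Fact lpolyZDl u : {morph lpolyZ^~ u : p q / p + q}.
Proof.
move=> p q; apply: lpolyP => n /=; rewrite -big_split /=.
by apply: eq_bigr => i _; rewrite coefD scalerDl.
Qed.

HB.instance Definition _ := GRing.Zmodule_isLmodule.Build {poly K} (lpoly M)
  lpolyZA lpoly1Z lpolyZDr lpolyZDl.

End LPolyLmod.

Section Superalgebra.
(* A C[d]-module is an lmodType over {poly C}, the derivation d acting as the
   scalar 'X. *)
Variables (C : comNzRingType) (A : lmodType {poly C}).

(* The scalars d and lambda of C[d][lambda] (acting on A[lambda]), then
   d, lambda and mu of C[d][lambda][mu] (acting on A[lambda][mu]). *)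
Definition d1 : {poly {poly C}} := 'X%:P.
Definition l1 : {poly {poly C}} := 'X.
Definition d2 : {poly {poly {poly C}}} := 'X%:P%:P.
Definition l2 : {poly {poly {poly C}}} := 'X%:P.
Definition m2 : {poly {poly {poly C}}} := 'X.

(* The substitution sum_n lambda^n c_n |-> sum_n t^n c_n, with values in
   A[lambda] for t in C[d][lambda], resp. in A[lambda][mu] for t in
   C[d][lambda][mu]. *)
Definition subst1 (t : {poly {poly C}}) (u : lpoly A) : lpoly A :=
  \sum_(n < lsize u) t ^+ n *: lconst (u n).
Definition subst2 (t : {poly {poly {poly C}}}) (u : lpoly A) :
    lpoly (lpoly A) :=
  \sum_(n < lsize u) t ^+ n *: lconst (lconst (u n)).

Implicit Types (f g : A -> A -> lpoly A).

(* nestr f g s t a b c is a f_s (b g_t c) and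
   nestl f g s t a b c is (a f_s b) g_t c. *)
Definition nestr f g (s t : {poly {poly {poly C}}}) (a b c : A) :
    lpoly (lpoly A) :=
  \sum_(n < lsize (g b c)) t ^+ n *: subst2 s (f a (g b c n)).
Definition nestl f g (s t : {poly {poly {poly C}}}) (a b c : A) :
    lpoly (lpoly A) :=
  \sum_(n < lsize (f a b)) s ^+ n *: subst2 t (g (f a b n) c).

(* A = A_0 (+) A_1 as C[d]-modules; gr i is A_i, with false for even and true
   for odd. *)
Record Z2_grading (gr : bool -> A -> Prop) : Prop := {
  gr0 : forall i, gr i 0;
  grD : forall i a b, gr i a -> gr i b -> gr i (a + b);
  grZ : forall i (p : {poly C}) a, gr i a -> gr i (p *: a);
  gr_sum : forall a, exists a0 a1, [/\ gr false a0, gr true a1 & a = a0 + a1];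
  gr_direct : forall a, gr false a -> gr true a -> a = 0 }.

Variable gr : bool -> A -> Prop.

Record even_lambda_product f : Prop := {
  lp_linl : forall (k : C) a b c,
    f (k%:P *: a + b) c = k%:P%:P *: f a c + f b c;
  lp_linr : forall (k : C) a b c,
    f a (k%:P *: b + c) = k%:P%:P *: f a b + f a c;
  lp_even : forall i j a b n, gr i a -> gr j b -> gr (i (+) j) (f a b n);
  lp_sesquil : forall a b, f ('X *: a) b = - l1 *: f a b;
  lp_sesquir : forall a b, f a ('X *: b) = (d1 + l1) *: f a b }.

Definition lp_commutative f : Prop :=
  forall i j a b, gr i a -> gr j b ->
    f a b = (-1) ^+ (i && j) *: subst1 (- d1 - l1) (f b a).

Definition lp_associative f : Prop :=
  forall a b c, nestr f f l2 m2 a b c = nestl f f l2 (l2 + m2) a b c.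

Record Lie_conformal_superalgebra f : Prop := {
  lie_lp : even_lambda_product f;
  lie_skew : forall i j a b, gr i a -> gr j b ->
    f a b = - ((-1) ^+ (i && j) *: subst1 (- l1 - d1) (f b a));
  lie_jacobi : forall i j a b c, gr i a -> gr j b ->
    nestr f f l2 m2 a b c =
      nestl f f l2 (l2 + m2) a b c
      + (-1) ^+ (i && j) *: nestr f f m2 l2 b a c }.

Definition transposed_Leibniz (op br : A -> A -> lpoly A) : Prop :=
  forall i j a b c, gr i a -> gr j b ->
    2 *: nestr op br l2 m2 a b c =
      nestl op br l2 (l2 + m2) a b c
      + (-1) ^+ (i && j) *: nestr br op m2 l2 b a c.

Record TPCSA (op br : A -> A -> lpoly A) : Prop := {
  tp_grading : Z2_grading gr;
  tp_lp : even_lambda_product op;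
  tp_comm : lp_commutative op;
  tp_assoc : lp_associative op;
  tp_lie : Lie_conformal_superalgebra br;
  tp_leibniz : transposed_Leibniz op br }.

End Superalgebra.

Section RankTwo.
Variable C : fieldType.

Definition Rmod : lmodType {poly C} := ({poly C}^o * {poly C}^o)%type.
Definition gx : Rmod := (1, 0).
Definition gy : Rmod := (0, 1).

Definition Rgr (i : bool) (a : Rmod) : Prop :=
  if i then exists p : {poly C}, a = p *: gy
  else exists p : {poly C}, a = p *: gx.

Local Notation X := (lconst gx).
Local Notation Y := (lconst gy).
Local Notation d := (@d1 C).
Local Notation l := (@l1 C).
Local Notation Rprod := (Rmod -> Rmod -> lpoly Rmod).
Local Notation "k %:S" := (k%:P%:P : {poly {poly C}})
  (at level 2, left associativity, format "k %:S").

(* The Lie conformal superalgebras R_1, ..., R_5.  For p in C[t], the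
   polynomials p(d) and p(lambda) of C[d][lambda] are p%:P and p^:P. *)
Definition is_R1 (p : {poly C}) (br : Rprod) : Prop :=
  [/\ Lie_conformal_superalgebra Rgr br,
      br gx gx = 0, br gx gy = 0 & br gy gy = p%:P *: X].

Definition is_R2 (q : {poly C}) (br : Rprod) : Prop :=
  [/\ Lie_conformal_superalgebra Rgr br,
      br gx gx = 0, br gy gy = 0 & br gx gy = q^:P *: Y].

Definition is_R3 (br : Rprod) : Prop :=
  [/\ Lie_conformal_superalgebra Rgr br,
      br gx gx = (d + 2 * l) *: X, br gx gy = 0 & br gy gy = 0].

Definition is_R4 (beta gamma : C) (br : Rprod) : Prop :=
  [/\ Lie_conformal_superalgebra Rgr br,
      br gx gx = (d + 2 * l) *: X,
      br gx gy = (d + beta%:S * l + gamma%:S) *: Y & br gy gy = 0].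

Definition is_R5 (alpha : C) (br : Rprod) : Prop :=
  [/\ Lie_conformal_superalgebra Rgr br,
      br gx gx = (d + 2 * l) *: X,
      br gx gy = (d + (3 / 2)%:S * l) *: Y & br gy gy = alpha%:S *: X].

Definition abelian (br : Rprod) : Prop := forall a b, br a b = 0.

(* The product with the given values on the generators, y o x being obtained
   from x o y by commutativity. *)
Definition given_by (op : Rprod) (xx xy yy : lpoly Rmod) : Prop :=
  [/\ op gx gx = xx, op gx gy = xy, op gy gy = yy
    & op gy gx = subst1 (- d - l) (op gx gy)].

End RankTwo.

(* Main.v *)
(* By sesquilinearity and parity, an even lambda-product f on R is determined by
   four polynomials f_ij(d, lambda), the coefficients of f on the generators,
   and the axioms of a TPCSA become functional equations between the f_ij.
   Over an infinite field these may be read pointwise, at d = s, lambda = t,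
   mu = r.  The transposed Leibniz rule at mu = 0, taken with the generator x of
   a Virasoro algebra, then forces most coefficients to vanish or to be constant:
   it has the shape w(s, t) f(s, t) = (known) with w a nonzero polynomial.  For
   R_2 one compares leading coefficients in d instead, and a root z of q gives
   q(r) f_xy(z - r) = 0.  For R_1 everything but y o y vanishes, and commutativity
   says that y o y is odd under lambda |-> -d - lambda, i.e. as a function of
   d + 2 lambda for d fixed. *)
Require Import Defs.
From HB Require Import structures.
From mathcomp Require Import all_boot all_order all_algebra.
From mathcomp Require Import boolp reals.
From mathcomp Require Import complex.
From mathcomp Require Import ring.
Set Implicit Arguments.
Unset Strict Implicit.
Unset Printing Implicit Defensive.
Import GRing.Theory.
Local Open Scope ring_scope.

(** * Polynomials as functions on a domain of characteristic zero *)

Section PolynomialFunctions.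
Variable C : numDomainType.

Lemma poly_eq0 (p : {poly C}) : (forall x, p.[x] = 0) -> p = 0.
Proof.
move=> p0; apply/eqP/contraT => p_neq0.
pose rs : seq C := [seq k%:R | k <- iota 0 (size p)].
suff /(max_poly_roots p_neq0) : all (root p) rs.
  rewrite size_map size_iota ltnn map_inj_uniq ?iota_uniq; first by apply.
  by move=> m n /eqP; rewrite Num.Theory.eqr_nat => /eqP.
by apply/allP => x _; rewrite rootE p0.
Qed.

Lemma poly_fun_inj (p q : {poly C}) : (forall x, p.[x] = q.[x]) -> p = q.
Proof.
by move=> pq; apply/subr0_eq/poly_eq0 => x; rewrite hornerD hornerN pq subrr.
Qed.

(** The conclusion also covers the roots of [w], because the cancellation takes place in the
    integral domain of polynomials and not value by value. *)
Lemma poly_fun_mulfI (w p q : {poly C}) : w != 0 ->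
  (forall x, w.[x] * p.[x] = w.[x] * q.[x]) -> forall x, p.[x] = q.[x].
Proof.
move=> w0 wpq x; congr (_.[x]); apply: (mulfI w0).
by apply: poly_fun_inj => y; rewrite !hornerM wpq.
Qed.

Lemma poly_neq0_ex (p : {poly C}) : p != 0 -> exists x, p.[x] != 0.
Proof.
move=> p0; apply: contrapT => np; move/eqP: p0; apply; apply: poly_eq0 => x.
by apply/eqP/contraT => px; case: np; exists x.
Qed.

(** This is the shape, as a polynomial in d, of the transposed Leibniz rule on [x], [x], [y] for
    R_2. *)
Lemma poly_shift_double (p : {poly C}) (c e : C) :
  (forall x, 2 * p.[x] = e + p.[x + c]) -> forall x, p.[x] = e.
Proof.
move=> dbl x; pose u := p - e%:P.
(* Doubling u and shifting its variable have different effects on lead_coef. *)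
have uE : 2%:R *: u = u \Po ('X + c%:P).
  apply: poly_fun_inj => y; rewrite hornerZ horner_comp !hornerE.
  by rewrite mulrDr dbl; ring.
have : lead_coef (2%:R *: u) = lead_coef u.
  by rewrite uE lead_coef_comp ?size_XaddC // lead_coefXaddC expr1n mulr1.
rewrite lead_coefZ mulr_natl mulr2n => /eqP.
rewrite -subr_eq0 addrK lead_coef_eq0 subr_eq0 => /eqP ->.
by rewrite hornerC.
Qed.

End PolynomialFunctions.

(** * Evaluation of polynomials with coefficients in a module *)

Section Evaluation.
Variables (M : zmodType) (S : comNzRingType).
Implicit Types (u v : lpoly M) (t : S).

(** [e] is a bare function here, so that [evl_lin] can combine two different ones; additivity enters
    with [evl_bound]. *)
Definition evl (e : M -> S) (t : S) (u : lpoly M) : S :=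
  \sum_(n < lsize u) t ^+ n * e (u n).

Lemma evl_lin (e1 e2 : M -> S) (k1 k2 : S) t u :
  evl (fun a => k1 * e1 a + k2 * e2 a) t u = k1 * evl e1 t u + k2 * evl e2 t u.
Proof.
rewrite /evl !mulr_sumr -big_split /=; apply: eq_bigr => n _.
by rewrite mulrDr !(mulrCA (t ^+ n)).
Qed.

Lemma eq_evl (e1 e2 : M -> S) : e1 =1 e2 -> forall t, evl e1 t =1 evl e2 t.
Proof. by move=> E t u; apply: eq_bigr => n _; rewrite E. Qed.

Variable e : {additive M -> S}.

(** [lsize] is some chosen bound, unrelated for [u], [v] and [u - v]. Independence of the bound lets
    them share one, which gives additivity of [evl e t]. *)
Lemma evl_bound N t u : (forall n, (N <= n)%N -> u n = 0) ->
  evl e t u = \sum_(n < N) t ^+ n * e (u n).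
Proof.
have widen m n : (m <= n)%N -> (forall i, (m <= i)%N -> u i = 0) ->
    \sum_(i < m) t ^+ i * e (u i) = \sum_(i < n) t ^+ i * e (u i).
  move=> le_mn u0; rewrite (big_ord_widen n (fun i => t ^+ i * e (u i))) //.
  rewrite big_mkcond; apply: eq_bigr => i _.
  by case: ltnP => // /u0 ->; rewrite raddf0 mulr0.
move=> u0; rewrite /evl; have [le|/ltnW le] := leqP (lsize u) N.
  by apply: widen => // i; apply: lsizeP.
by rewrite (widen _ _ le).
Qed.

Fact evl_is_zmod_morphism t : zmod_morphism (evl e t).
Proof.
move=> u v; pose N := maxn (lsize u) (lsize v).
have uN n : (N <= n)%N -> u n = 0.
  by rewrite geq_max => /andP[? _]; apply: lsizeP.
have vN n : (N <= n)%N -> v n = 0.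
  by rewrite geq_max => /andP[_ ?]; apply: lsizeP.
rewrite !(evl_bound (N := N)) // => [|n le]; last by rewrite /= uN ?vN // oppr0 addr0.
rewrite -sumrB; apply: eq_bigr => n _ /=.
by rewrite -mulrBr -raddfB.
Qed.

HB.instance Definition _ t :=
  GRing.isZmodMorphism.Build (lpoly M) S (evl e t) (evl_is_zmod_morphism t).

Lemma evl_lconst t (a : M) : evl e t (lconst a) = e a.
Proof.
by rewrite (evl_bound (N := 1%N)) => [|[]//]; rewrite big_ord1 expr0 mul1r.
Qed.

End Evaluation.

Section EvaluationScale.
Variables (K : nzRingType) (M : lmodType K) (S : comNzRingType).
Variables (h : {rmorphism K -> S}) (e : {additive M -> S}).
Hypothesis eZ : forall k a, e (k *: a) = h k * e a.

(** The evaluation of scalars that goes with [evl]: [h] on coefficients, then the variable set to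
    [t]. *)
Definition evs (t : S) : {poly K} -> S := horner_morph (fun x => mulrC t (h x)).
HB.instance Definition _ t := GRing.RMorphism.copy (evs t)
  (horner_morph (fun x => mulrC t (h x))).

Lemma evsC t k : evs t k%:P = h k. Proof. exact: horner_morphC. Qed.
Lemma evsX t : evs t 'X = t. Proof. exact: horner_morphX. Qed.

Lemma evlZ t (p : {poly K}) (u : lpoly M) :
  evl e t (p *: u) = evs t p * evl e t u.
Proof.
elim/poly_ind: p u => [|p c IHp] u; first by rewrite scale0r !raddf0 mul0r.
rewrite scalerDl raddfD /= -scalerA IHp !rmorphD rmorphM /= mulrDl -mulrA evsX evsC.
congr (_ * _ + _).
  (* Multiplication by ['X] shifts the coefficients of [u] up by one, hence the bound
     [(lsize u).+1]. *)
  rewrite (evl_bound _ (N := (lsize u).+1)) => [|[|n] le]; first last.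
  - by rewrite /= big_ord_recl big_ord_recl /= !coefX scale0r add0r scale1r subn1
      lsizeP // big1 ?addr0 // => i _; rewrite coefX scale0r.
  - by [].
  rewrite big_ord_recl /= big_ord1 coefX scale0r raddf0 mulr0 add0r.
  rewrite mulr_sumr; apply: eq_bigr => i _ /=.
  rewrite big_ord_recl big_ord_recl /= !coefX scale0r add0r scale1r subn1 /=.
  by rewrite big1 ?addr0 ?exprS ?mulrA // => j _; rewrite coefX scale0r.
have cE n : (c%:P *: u) n = c *: u n.
  rewrite /= big_ord_recl subn0 coefC big1 ?addr0 // => i _.
  by rewrite coefC scale0r.
rewrite (evl_bound _ (N := lsize u)) => [|n /lsizeP u0].
  by rewrite mulr_sumr; apply: eq_bigr => n _; rewrite cE eZ mulrCA.
by rewrite cE u0 scaler0.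
Qed.

End EvaluationScale.

(** The values [e (u n)] are the coefficients of an ordinary polynomial that vanishes everywhere.
    Used at each level of nesting, this justifies reading identities pointwise. *)
Lemma evl_eq0 (M : zmodType) (C : numDomainType) (e : {additive M -> C}) (u : lpoly M) :
  (forall t, evl e t u = 0) -> forall n, e (u n) = 0.
Proof.
move=> u0 n; have [lt|/lsizeP->] := ltnP n (lsize u); last exact: raddf0.
pose p := \poly_(k < lsize u) e (u k).
suff p0 : p = 0.
  by have := coef_poly (lsize u) (fun k => e (u k)) n; rewrite lt -/p p0 coef0.
apply: poly_eq0 => t; rewrite horner_poly -[RHS](u0 t) /evl.
by apply: eq_bigr => i _; rewrite mulrC.
Qed.

(** * Pointwise form of products and nested products on the rank two module *)

Section RankTwoEvaluation.
Variable C : numFieldType.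
Local Notation V := (Rmod C).
Local Notation gx := (gx C).
Local Notation gy := (gy C).
Implicit Types (i j : bool) (s t r : C) (a b c : V).

Definition rcoef i a : {poly C} := if i then a.2 else a.1.
Definition ev0 i s a : C := (rcoef i a).[s].

Fact ev0_is_zmod_morphism i s : zmod_morphism (ev0 i s).
Proof. by move=> a b; rewrite /ev0 /rcoef; case: i; rewrite /= hornerD hornerN. Qed.
HB.instance Definition _ i s :=
  GRing.isZmodMorphism.Build V C (ev0 i s) (ev0_is_zmod_morphism i s).

Lemma ev0Z i s (p : {poly C}) a : ev0 i s (p *: a) = horner_eval s p * ev0 i s a.
Proof. by rewrite /ev0 /rcoef; case: i; rewrite /= hornerM. Qed.

Lemma ev0_gx i s : ev0 i s gx = (~~ i)%:R.
Proof. by case: i; rewrite /ev0 /= hornerE. Qed.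
Lemma ev0_gy i s : ev0 i s gy = i%:R.
Proof. by case: i; rewrite /ev0 /= hornerE. Qed.

Lemma ev0_inj a b : (forall i s, ev0 i s a = ev0 i s b) -> a = b.
Proof.
by move=> E; case: a b E => [a1 a2] [b1 b2] E; congr pair;
  apply: poly_fun_inj => s; [apply: (E false s) | apply: (E true s)].
Qed.

Lemma ev0_hom i j s a : Rgr i a -> j != i -> ev0 j s a = 0.
Proof. by case: i j => -[] //= [p ->] _; rewrite ev0Z (ev0_gx, ev0_gy) mulr0. Qed.

Lemma gens_decomp a : a = (a.1 : {poly C}) *: gx + (a.2 : {poly C}) *: gy.
Proof.
apply: ev0_inj => i s; rewrite raddfD /= !ev0Z ev0_gx ev0_gy /ev0 /horner_eval.
by case: i; rewrite /= mulr0 mulr1 ?add0r ?addr0.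
Qed.

Lemma Rgr_gx : Rgr false gx. Proof. by exists 1; rewrite scale1r. Qed.
Lemma Rgr_gy : Rgr true gy. Proof. by exists 1; rewrite scale1r. Qed.

Lemma Rgr_grading : Z2_grading (@Rgr C).
Proof.
split.
- by case; exists 0; rewrite scale0r.
- by case=> a b [p ->] [q ->]; exists (p + q); rewrite scalerDl.
- by case=> p a [q ->]; exists (p * q); rewrite scalerA.
- move=> a; exists ((a.1 : {poly C}) *: gx), ((a.2 : {poly C}) *: gy); split.
  + by exists a.1.
  + by exists a.2.
  + exact: gens_decomp.
- move=> a ax ay; apply: ev0_inj => i s; rewrite raddf0.
  by case: i; [apply: ev0_hom ax _ | apply: ev0_hom ay _].
Qed.

Local Notation ev1 i s t := (evl (ev0 i s) t).
Local Notation ev2 i s t r := (evl (ev1 i s t) r).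
(** [evs1] sets d = s and lambda = t; [evs2] also sets mu = r, the outermost variable. *)
Definition evs1 s t : {rmorphism {poly {poly C}} -> C} := evs (horner_eval s) t.
Definition evs2 s t r : {rmorphism {poly {poly {poly C}}} -> C} := evs (evs1 s t) r.

Lemma ev1Z i s t P (u : lpoly V) : ev1 i s t (P *: u) = evs1 s t P * ev1 i s t u.
Proof. exact/evlZ/ev0Z. Qed.
Lemma ev2Z i s t r P (u : lpoly (lpoly V)) :
  ev2 i s t r (P *: u) = evs2 s t r P * ev2 i s t r u.
Proof. by apply: evlZ => P' u'; apply: ev1Z. Qed.

Lemma evs1_d s t : evs1 s t (d1 C) = s.
Proof. exact: etrans (evsC (horner_eval s) t ('X : {poly C})) (hornerX s). Qed.
Lemma evs1_l s t : evs1 s t (l1 C) = t. Proof. exact: evsX. Qed.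
Lemma evs1_C s t (p : {poly C}) : evs1 s t p%:P = p.[s].
Proof. exact: evsC. Qed.
Lemma evs1_map s t (q : {poly C}) : evs1 s t q^:P = q.[t].
Proof.
elim/poly_ind: q => [|q k IH]; first by rewrite !rmorph0 horner0.
rewrite rmorphD rmorphM /= map_polyX map_polyC rmorphD rmorphM IH.
by rewrite [evs1 s t 'X]evs1_l evs1_C !hornerE.
Qed.
Lemma evs2_l s t r : evs2 s t r (l2 C) = t.
Proof. exact: etrans (evsC (evs1 s t) r (l1 C)) (evs1_l s t). Qed.
Lemma evs2_m s t r : evs2 s t r (m2 C) = r. Proof. exact: evsX. Qed.

Lemma ev1_inj (u v : lpoly V) : (forall i s t, ev1 i s t u = ev1 i s t v) -> u = v.
Proof.
move=> E; apply: lpolyP => n; apply: ev0_inj => i s.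
apply/subr0_eq; rewrite -raddfB; apply: (evl_eq0 (u := u - v)) => t.
by rewrite raddfB /= E subrr.
Qed.
Lemma ev2_inj (u v : lpoly (lpoly V)) :
  (forall i s t r, ev2 i s t r u = ev2 i s t r v) -> u = v.
Proof.
move=> E; apply: lpolyP => n; apply: ev1_inj => i s t.
apply/subr0_eq; rewrite -raddfB; apply: (evl_eq0 (u := u - v)) => r.
by rewrite raddfB /= E subrr.
Qed.

Lemma ev1_subst1 i s t T (u : lpoly V) :
  ev1 i s t (subst1 T u) = ev1 i s (evs1 s t T) u.
Proof.
rewrite /subst1 raddf_sum; apply: eq_bigr => n _ /=.
by rewrite ev1Z rmorphXn evl_lconst.
Qed.
Lemma ev2_subst2 i s t r T (u : lpoly V) :
  ev2 i s t r (subst2 T u) = ev1 i s (evs2 s t r T) u.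
Proof.
rewrite /subst2 raddf_sum; apply: eq_bigr => n _ /=.
by rewrite ev2Z rmorphXn evl_lconst /= evl_lconst.
Qed.

Lemma ev1_poly i t (u : lpoly V) : exists p : {poly C}, forall s, p.[s] = ev1 i s t u.
Proof.
exists (\sum_(n < lsize u) (t ^+ n) *: rcoef i (u n)) => s.
by rewrite horner_sum; apply: eq_bigr => n _; rewrite hornerZ.
Qed.

Section Product.
Variable f : V -> V -> lpoly V.
Hypothesis fP : even_lambda_product (@Rgr C) f.

Lemma lp_addl a b c : f (a + b) c = f a c + f b c.
Proof. by have := lp_linl fP 1 a b c; rewrite !scale1r. Qed.
Lemma lp_addr a b c : f a (b + c) = f a b + f a c.
Proof. by have := lp_linr fP 1 a b c; rewrite !scale1r. Qed.
Lemma lp_0l a : f 0 a = 0.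
Proof. by apply: (addrI (f 0 a)); rewrite -lp_addl !addr0. Qed.
Lemma lp_0r a : f a 0 = 0.
Proof. by apply: (addrI (f a 0)); rewrite -lp_addr !addr0. Qed.

(* The left argument is evaluated at d = -lambda, the right one at d + lambda. *)
Lemma ev1_Zl i s t p a b : ev1 i s t (f (p *: a) b) = p.[- t] * ev1 i s t (f a b).
Proof.
elim/poly_ind: p a => [|p k IH] a; first by rewrite scale0r lp_0l horner0 mul0r raddf0.
rewrite scalerDl -scalerA addrC (lp_linl fP) raddfD /= IH ev1Z evs1_C.
by rewrite (lp_sesquil fP) ev1Z rmorphN evs1_l !hornerE /=; ring.
Qed.
Lemma ev1_Zr i s t p a b : ev1 i s t (f a (p *: b)) = p.[s + t] * ev1 i s t (f a b).
Proof.
elim/poly_ind: p b => [|p k IH] b; first by rewrite scale0r lp_0r horner0 mul0r raddf0.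
rewrite scalerDl -scalerA addrC (lp_linr fP) raddfD /= IH ev1Z evs1_C.
by rewrite (lp_sesquir fP) ev1Z rmorphD evs1_d evs1_l !hornerE /=; ring.
Qed.

Definition gen i : V := if i then gy else gx.
Lemma Rgr_gen i : Rgr i (gen i).
Proof. by case: i; [apply: Rgr_gy | apply: Rgr_gx]. Qed.

Lemma ev1_hom i j k s t a b : Rgr i a -> Rgr j b -> k != i (+) j ->
  ev1 k s t (f a b) = 0.
Proof.
move=> ai bj kij; rewrite /evl big1 // => n _.
by rewrite (ev0_hom _ (lp_even fP n ai bj)) ?mulr0.
Qed.

(** Of the four products of generators, two have the wrong parity for component [i]. The factors
    free of [b] are grouped in front so that [evl_lin] applies when [b] runs over the coefficients
    of an inner product. *)
Lemma ev1E i s t a b : ev1 i s t (f a b) =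
  (ev0 false (- t) a * ev1 i s t (f gx (gen i))) * ev0 i (s + t) b
  + (ev0 true (- t) a * ev1 i s t (f gy (gen (~~ i)))) * ev0 (~~ i) (s + t) b.
Proof.
rewrite {1}[a]gens_decomp {1}[b]gens_decomp lp_addl !lp_addr !raddfD /=.
rewrite !ev1_Zl !ev1_Zr /ev0.
case: i => /=.
  rewrite (ev1_hom (k := true) s t Rgr_gx Rgr_gx) //.
  by rewrite (ev1_hom (k := true) s t Rgr_gy Rgr_gy) //; ring.
rewrite (ev1_hom (k := false) s t Rgr_gx Rgr_gy) //.
by rewrite (ev1_hom (k := false) s t Rgr_gy Rgr_gx) //; ring.
Qed.
End Product.

Section Nested.
Variables f g : V -> V -> lpoly V.
Hypotheses (fP : even_lambda_product (@Rgr C) f) (gP : even_lambda_product (@Rgr C) g).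

(** The inner product is a right argument, hence evaluated at d plus the outer variable. *)
Lemma ev2_nestr i s t r S T a b c : 
  let t' := evs2 s t r S in let r' := evs2 s t r T in
  ev2 i s t r (nestr f g S T a b c) =
  (ev0 false (- t') a * ev1 i s t' (f gx (gen i))) * ev1 i (s + t') r' (g b c)
  + (ev0 true (- t') a * ev1 i s t' (f gy (gen (~~ i))))
    * ev1 (~~ i) (s + t') r' (g b c).
Proof.
move=> t' r'; rewrite -evl_lin -(eq_evl (fun x => ev1E fP i s t' a x)).
rewrite /nestr raddf_sum; apply: eq_bigr => n _ /=.
by rewrite ev2Z rmorphXn ev2_subst2.
Qed.

(** The inner product is a left argument, hence evaluated at d equal to minus the outer variable. *)
Lemma ev2_nestl i s t r S T a b c : 
  let t' := evs2 s t r S in let r' := evs2 s t r T in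
  ev2 i s t r (nestl f g S T a b c) =
  (ev0 i (s + r') c * ev1 i s r' (g gx (gen i))) * ev1 false (- r') t' (f a b)
  + (ev0 (~~ i) (s + r') c * ev1 i s r' (g gy (gen (~~ i))))
    * ev1 true (- r') t' (f a b).
Proof.
move=> t' r'; rewrite -evl_lin /nestl raddf_sum; apply: eq_bigr => n _ /=.
by rewrite ev2Z rmorphXn ev2_subst2 (ev1E gP); congr (_ * _); ring.
Qed.
End Nested.

End RankTwoEvaluation.
Arguments Rgr_gen {C} i.

(** * The axioms as functional equations between the structure functions *)

Section StructureFunctions.
Variable C : numFieldType.
Local Notation V := (Rmod C).
Local Notation gx := (gx C).
Local Notation gy := (gy C).
Local Notation gen := (@gen C).
Local Notation ev1 i s t := (evl (ev0 i s) t).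
Local Notation ev2 i s t r := (evl (ev1 i s t) r).
Implicit Types (f g op br : V -> V -> lpoly V) (i j k : bool) (s t r : C).

(* The value of f_ij at d = s, lambda = t; i, j are the parities of the generators,
   so that i (+) j is the only component that f (gen i) (gen j) may have. *)
Definition sfun f i j s t : C := ev1 (i (+) j) s t (f (gen i) (gen j)).
Arguments sfun : simpl never.

Lemma ev0_gen i j s : ev0 i s (gen j) = (i == j)%:R.
Proof. by case: i j => -[]; rewrite (ev0_gx, ev0_gy). Qed.

Lemma sfun_poly f i j t : exists p : {poly C}, forall s, p.[s] = sfun f i j s t.
Proof. exact: ev1_poly. Qed.

Lemma evs1_comp s t (P Q : {poly {poly C}}) :
  evs1 s t (P \Po Q) = evs1 s (evs1 s t Q) P.
Proof.
elim/poly_ind: P => [|P c IH]; first by rewrite comp_poly0 !rmorph0.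
rewrite comp_poly_MXaddC !rmorphD !rmorphM IH [evs1 _ _ 'X]evs1_l.
by rewrite !evs1_C.
Qed.

Lemma sfun_bipoly f i j :
  exists P : {poly {poly C}}, forall s t, sfun f i j s t = evs1 s t P.
Proof.
pose u := f (gen i) (gen j).
exists (\sum_(n < lsize u) (l1 C) ^+ n * (rcoef (i (+) j) (u n))%:P) => s t.
by rewrite rmorph_sum; apply: eq_bigr => n _; rewrite rmorphM rmorphXn evs1_l evs1_C.
Qed.

Lemma ev1_sfun f (fP : even_lambda_product (@Rgr C) f) k s t (a b : V) :
  ev1 k s t (f a b) =
  ev0 false (- t) a * sfun f false k s t * ev0 k (s + t) b
  + ev0 true (- t) a * sfun f true (~~ k) s t * ev0 (~~ k) (s + t) b.
Proof. by rewrite (ev1E fP) /sfun addTb negbK. Qed.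

Lemma sfun_eq f (fP : even_lambda_product (@Rgr C) f) i j P :
  f (gen i) (gen j) = P *: lconst (gen (i (+) j)) <->
  (forall s t, sfun f i j s t = evs1 s t P).
Proof.
split=> [E s t|E]; first by rewrite /sfun E ev1Z evl_lconst /= ev0_gen eqxx mulr1.
apply: ev1_inj => k s t; rewrite ev1Z evl_lconst /= ev0_gen -E.
have [->|kij] := eqVneq k (i (+) j); first by rewrite mulr1.
by rewrite mulr0; exact: (ev1_hom fP s t (Rgr_gen i) (Rgr_gen j) kij).
Qed.

(** These three predicates are the axioms on generators at d = s, lambda = t, mu = r. An inner
    product on the right has d shifted by the outer variable; one on the left has d = -(lambda +
    mu). *)
Definition sfun_comm op := forall i j s t,
  sfun op i j s t = (-1) ^+ (i && j) * sfun op j i s (- s - t).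

Definition sfun_assoc op := forall i j k s t r,
  sfun op i (j (+) k) s t * sfun op j k (s + t) r =
  sfun op (i (+) j) k s (t + r) * sfun op i j (- (t + r)) t.

Definition sfun_leibniz op br := forall i j k s t r,
  2 * (sfun op i (j (+) k) s t * sfun br j k (s + t) r) =
  sfun br (i (+) j) k s (t + r) * sfun op i j (- (t + r)) t
  + (-1) ^+ (i && j) * (sfun br j (i (+) k) s r * sfun op i k (s + r) t).

Lemma lp_commutativeP op (opP : even_lambda_product (@Rgr C) op) :
  lp_commutative (@Rgr C) op <-> sfun_comm op.
Proof.
split=> [comm i j s t|comm i j a b ai bj].
  rewrite /sfun (comm _ _ _ _ (Rgr_gen i) (Rgr_gen j)) ev1Z rmorph_sign.
  by rewrite ev1_subst1 rmorphB rmorphN evs1_d evs1_l addbC.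
apply: ev1_inj => k s t; rewrite ev1Z rmorph_sign ev1_subst1 rmorphB rmorphN.
rewrite evs1_d evs1_l !(ev1_sfun opP).
have -> : s + (- s - t) = - t by ring.
have -> : - (- s - t) = s + t by ring.
have a0 x : ev0 (~~ i) x a = 0 by apply: ev0_hom ai _; case: (i).
have b0 x : ev0 (~~ j) x b = 0 by apply: ev0_hom bj _; case: (j).
move: comm a0 b0; case: i j k {ai bj} => -[] -[] /= comm a0 b0;
  rewrite ?a0 ?b0 ?expr0 ?expr1 ?(mul0r, mulr0, addr0, add0r) //;
  by rewrite [in LHS]comm /= ?expr0 ?expr1; ring.
Qed.

Section Trilinear.
Variables f g : V -> V -> lpoly V.
Hypotheses (fP : even_lambda_product (@Rgr C) f) (gP : even_lambda_product (@Rgr C) g).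

(** The arguments contribute only a scalar factor. For the substitutions in the axioms it agrees
    with the one in [nestl_sfun], so each axiom reduces to generators. *)
Lemma nestr_sfun i j k s t r S T (a b c : V) : Rgr i a -> Rgr j b ->
  let t' := evs2 s t r S in let r' := evs2 s t r T in
  ev2 (i (+) j (+) k) s t r (nestr f g S T a b c) =
  ev0 i (- t') a * ev0 j (- r') b * ev0 k (s + t' + r') c
  * (sfun f i (j (+) k) s t' * sfun g j k (s + t') r').
Proof.
move=> ai bj t' r'; rewrite (ev2_nestr g fP) !(ev1_sfun gP).
have a0 x : ev0 (~~ i) x a = 0 by apply: ev0_hom ai _; case: (i).
have b0 x : ev0 (~~ j) x b = 0 by apply: ev0_hom bj _; case: (j).
move: a0 b0; rewrite /sfun; case: i j k {ai bj} => -[] -[] /= a0 b0;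
  rewrite ?a0 ?b0;
  by rewrite -/t' -/r'; ring.
Qed.

Lemma nestl_sfun i j k s t r S T (a b c : V) : Rgr i a -> Rgr j b ->
  let t' := evs2 s t r S in let r' := evs2 s t r T in
  ev2 (i (+) j (+) k) s t r (nestl f g S T a b c) =
  ev0 i (- t') a * ev0 j (t' - r') b * ev0 k (s + r') c
  * (sfun g (i (+) j) k s r' * sfun f i j (- r') t').
Proof.
move=> ai bj t' r'; rewrite (ev2_nestl f gP) !(ev1_sfun fP) -/t' -/r' (addrC (- r')).
have a0 x : ev0 (~~ i) x a = 0 by apply: ev0_hom ai _; case: (i).
have b0 x : ev0 (~~ j) x b = 0 by apply: ev0_hom bj _; case: (j).
move: a0 b0; rewrite /sfun; case: i j k {ai bj} => -[] -[] /= a0 b0;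
  rewrite ?a0 ?b0;
  by ring.
Qed.

(** Associativity is demanded of all elements; additivity in the first two arguments reduces it to
    homogeneous ones. *)
Lemma nestrDl S T a a' b c :
  nestr f g S T (a + a') b c = nestr f g S T a b c + nestr f g S T a' b c.
Proof.
by apply: ev2_inj => i s t r; rewrite raddfD /= !(ev2_nestr g fP) !raddfD /=; ring.
Qed.
Lemma nestrDm S T a b b' c :
  nestr f g S T a (b + b') c = nestr f g S T a b c + nestr f g S T a b' c.
Proof.
apply: ev2_inj => i s t r; rewrite raddfD /= !(ev2_nestr g fP) !(lp_addl gP).
by rewrite !raddfD /=; ring.
Qed.
Lemma nestlDl S T a a' b c :
  nestl f g S T (a + a') b c = nestl f g S T a b c + nestl f g S T a' b c.
Proof.
apply: ev2_inj => i s t r; rewrite raddfD /= !(ev2_nestl f gP) !(lp_addl fP).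
by rewrite !raddfD /=; ring.
Qed.
Lemma nestlDm S T a b b' c :
  nestl f g S T a (b + b') c = nestl f g S T a b c + nestl f g S T a b' c.
Proof.
apply: ev2_inj => i s t r; rewrite raddfD /= !(ev2_nestl f gP) !(lp_addr fP).
by rewrite !raddfD /=; ring.
Qed.
End Trilinear.

(** Component [k] of a triple product sees only the part of parity [k'] of the third argument, so
    that argument is never split. *)
Lemma addbI3 i j k : exists k', k = i (+) j (+) k'.
Proof. by exists (i (+) j (+) k); rewrite addKb. Qed.

Lemma lp_assocP op (opP : even_lambda_product (@Rgr C) op) :
  lp_associative op <-> sfun_assoc op.
Proof.
split=> [assoc i j k s t r|assoc a b c].
  have := congr1 (ev2 (i (+) j (+) k) s t r) (assoc (gen i) (gen j) (gen k)).
  rewrite (nestr_sfun opP opP) ?(nestl_sfun opP opP); try exact: Rgr_gen.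
  by rewrite !rmorphD !evs2_l !evs2_m !ev0_gen !eqxx !mul1r.
have homog i j a' b' : Rgr i a' -> Rgr j b' ->
    nestr op op (l2 C) (m2 C) a' b' c = nestl op op (l2 C) (l2 C + m2 C) a' b' c.
  move=> ai bj; apply: ev2_inj => k s t r; have [k' ->] := addbI3 i j k.
  rewrite (nestr_sfun opP opP) // (nestl_sfun opP opP) // !rmorphD !evs2_l !evs2_m assoc.
  have -> : t - (t + r) = - r by ring. by rewrite addrA.
have [a0 [a1 [a0P a1P ->]]] := gr_sum (Rgr_grading C) a.
have [b0 [b1 [b0P b1P ->]]] := gr_sum (Rgr_grading C) b.
rewrite !(nestrDl op opP, nestlDl opP opP, nestrDm opP opP, nestlDm opP opP).
by rewrite (homog _ _ _ _ a0P b0P) (homog _ _ _ _ a0P b1P) (homog _ _ _ _ a1P b0P)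
  (homog _ _ _ _ a1P b1P).
Qed.

Lemma transposed_LeibnizP op br (opP : even_lambda_product (@Rgr C) op)
    (brP : even_lambda_product (@Rgr C) br) :
  transposed_Leibniz (@Rgr C) op br <-> sfun_leibniz op br.
Proof.
(* Both directions rest on this equivalence: on generators the common factor [x] is 1, and
   conversely the equation on generators is multiplied by [x]. *)
have ev i j k s t r (a b c : V) : Rgr i a -> Rgr j b ->
    (ev2 (i (+) j (+) k) s t r (2 *: nestr op br (l2 C) (m2 C) a b c) =
     ev2 (i (+) j (+) k) s t r (nestl op br (l2 C) (l2 C + m2 C) a b c
       + (-1) ^+ (i && j) *: nestr br op (m2 C) (l2 C) b a c)) <->
    let x := ev0 i (- t) a * ev0 j (- r) b * ev0 k (s + t + r) c in
    x * (2 * (sfun op i (j (+) k) s t * sfun br j k (s + t) r)) =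
    x * (sfun br (i (+) j) k s (t + r) * sfun op i j (- (t + r)) t
    + (-1) ^+ (i && j) * (sfun br j (i (+) k) s r * sfun op i k (s + r) t)).
  move=> ai bj; rewrite raddfD /= !ev2Z rmorph_sign rmorph_nat.
  rewrite (nestr_sfun opP brP) // (nestl_sfun opP brP) //.
  rewrite [in ev2 _ _ _ _ (nestr br _ _ _ _ _ _)](addbC i) (nestr_sfun brP opP) //.
  rewrite !rmorphD !evs2_l !evs2_m addrA.
  have -> : t - (t + r) = - r by ring.
  have -> : s + r + t = s + t + r by ring.
  set x := ev0 i _ a; set y := ev0 j _ b; set z := ev0 k _ c.
  set u := sfun op i _ s t; set v := sfun br j k _ r.
  split=> E; first by transitivity (2 * (x * y * z * (u * v))); [ring|rewrite E; ring].
  by transitivity (x * y * z * (2 * (u * v))); [ring|rewrite E; ring].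
split=> [leib i j k s t r|leib i j a b c ai bj].
  have /(ev i j k s t r _ _ _ (Rgr_gen i) (Rgr_gen j)) :=
    congr1 (ev2 (i (+) j (+) k) s t r) (leib _ _ _ _ (gen k) (Rgr_gen i) (Rgr_gen j)).
  by rewrite /= !ev0_gen !eqxx !mul1r.
apply: ev2_inj => k s t r; have [k' ->] := addbI3 i j k.
by apply/(ev _ _ _ _ _ _ _ _ _ ai bj); rewrite leib.
Qed.
End StructureFunctions.
Arguments sfun : simpl never.

(** * Classification of the compatible products *)

Section Classification.
Variable C : numClosedFieldType.
Local Notation V := (Rmod C).
Local Notation X := (lconst (gx C)).
Local Notation Y := (lconst (gy C)).
Variables op br : V -> V -> lpoly V.
Hypothesis opP : even_lambda_product (@Rgr C) op.
Implicit Types (s t r : C) (i j k : bool).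

Local Notation xx := (sfun op false false).
Local Notation xy := (sfun op false true).
Local Notation yx := (sfun op true false).
Local Notation yy := (sfun op true true).

Lemma sfun_eq0 f (fP : even_lambda_product (@Rgr C) f) i j :
  f (gen C i) (gen C j) = 0 <-> (forall s t, sfun f i j s t = 0).
Proof.
rewrite -(scale0r (lconst (gen C (i (+) j)))) (sfun_eq fP).
by split=> E s t; rewrite E rmorph0.
Qed.

(** [u], [v], [w] enter through equations so that a zero entry can be supplied as a zero multiple of
    a generator. *)
Lemma given_byP (P Q S : {poly {poly C}}) u v w :
  u = P *: X -> v = Q *: Y -> w = S *: X ->
  given_by op u v w <->
  [/\ forall s t, xx s t = evs1 s t P, forall s t, xy s t = evs1 s t Q,
      forall s t, yy s t = evs1 s t S & forall s t, yx s t = xy s (- s - t)].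
Proof.
move=> -> -> ->; split=> [[xxE xyE yyE yxE]|[xxE xyE yyE yxE]]; split.
- exact/(sfun_eq opP false false).
- exact/(sfun_eq opP false true).
- exact/(sfun_eq opP true true).
- by move=> s t; rewrite /sfun yxE ev1_subst1 rmorphB rmorphN evs1_d evs1_l.
- exact/(sfun_eq opP false false).
- exact/(sfun_eq opP false true).
- exact/(sfun_eq opP true true).
- apply: ev1_inj => i s t; rewrite ev1_subst1 rmorphB rmorphN evs1_d evs1_l.
  case: i; first exact: yxE.
  by rewrite (ev1_hom opP _ _ (Rgr_gy C) (Rgr_gx C)) //
    (ev1_hom opP _ _ (Rgr_gx C) (Rgr_gy C)).
Qed.

Lemma given_by0 : given_by op 0 0 0 <-> (forall i j s t, sfun op i j s t = 0).
Proof.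
rewrite (given_byP (P := 0) (Q := 0) (S := 0)) ?scale0r //.
split=> [[xxE xyE yyE yxE] i j s t|E]; last by split=> s t; rewrite !E ?rmorph0.
by case: i j => -[]; rewrite ?yxE ?xxE ?xyE ?yyE rmorph0.
Qed.

Lemma given_by_id (c : C) :
  given_by op (c%:P%:P *: X) (c%:P%:P *: Y) 0 <->
  [/\ forall s t, xx s t = c, forall s t, xy s t = c,
      forall s t, yy s t = 0 & forall s t, yx s t = c].
Proof.
rewrite (given_byP (P := c%:P%:P) (Q := c%:P%:P) (S := 0)) ?scale0r //.
split=> -[xxE xyE yyE yxE]; split=> s t;
  by rewrite ?yxE ?xxE ?xyE ?yyE ?evs1_C ?hornerC ?rmorph0.
Qed.

Lemma given_by_x (c : C) :
  given_by op (c%:P%:P *: X) 0 0 <->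
  [/\ forall s t, xx s t = c, forall s t, xy s t = 0,
      forall s t, yy s t = 0 & forall s t, yx s t = 0].
Proof.
rewrite (given_byP (P := c%:P%:P) (Q := 0) (S := 0)) ?scale0r //.
split=> -[xxE xyE yyE yxE]; split=> s t;
  by rewrite ?yxE ?xxE ?xyE ?yyE ?evs1_C ?hornerC ?rmorph0.
Qed.

Hypothesis brP : Lie_conformal_superalgebra (@Rgr C) br.

Lemma TPCSAP : TPCSA (@Rgr C) op br <->
  [/\ sfun_comm op, sfun_assoc op & sfun_leibniz op br].
Proof.
have brlp := lie_lp brP.
split=> [[_ _ comm assoc _ leib]|[comm assoc leib]]; split=> //.
- exact/lp_commutativeP.
- exact/lp_assocP.
- exact/transposed_LeibnizP.
- exact: Rgr_grading.
- exact/lp_commutativeP.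
- exact/lp_assocP.
- exact/transposed_LeibnizP.
Qed.

Lemma TPCSA_zero : given_by op 0 0 0 -> TPCSA (@Rgr C) op br.
Proof.
move=> /given_by0 E; apply/TPCSAP; split=> [i j s t|i j k s t r|i j k s t r].
- by rewrite !E mulr0.
- by rewrite !E mul0r.
- by rewrite !E !(mulr0, mul0r) addr0.
Qed.

Lemma abelianP : (forall i j s t, sfun br i j s t = 0) -> abelian br.
Proof.
move=> E a b; apply: ev1_inj => i s t.
by rewrite (ev1_sfun (lie_lp brP)) !E !(mulr0, mul0r) addr0 raddf0.
Qed.

Lemma TPCSA_abelian : abelian br ->
  TPCSA (@Rgr C) op br <-> lp_commutative (@Rgr C) op /\ lp_associative op.
Proof.
move=> ab; split=> [[]|[comm assoc]] //; split=> //; first exact: Rgr_grading.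
apply/(transposed_LeibnizP opP (lie_lp brP)) => i j k s t r.
by rewrite /sfun !ab !raddf0 !(mulr0, mul0r) addr0.
Qed.

Lemma sfun_skew s t : sfun br true false s t = - sfun br false true s (- t - s).
Proof.
rewrite /sfun (lie_skew brP (Rgr_gen true) (Rgr_gen false)) raddfN /= expr0 scale1r.
by rewrite ev1_subst1 rmorphB rmorphN evs1_d evs1_l.
Qed.

(** * The family R_1 *)

Lemma is_R1_sfun p : is_R1 p br ->
  (forall i j s t, ~~ (i && j) -> sfun br i j s t = 0) /\
  (forall s t, sfun br true true s t = p.[s]).
Proof.
have brlp := lie_lp brP => -[_ bxx bxy byy]; split=> [i j s t|s t]; last first.
  by rewrite ((sfun_eq brlp true true p%:P).1 byy) evs1_C.
have xy0 := (sfun_eq0 brlp false true).1 bxy.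
by case: i j => -[] // _; rewrite ?sfun_skew ?xy0 ?oppr0
  ?((sfun_eq0 brlp false false).1 bxx).
Qed.

(** A polynomial odd in v is v times a polynomial in v^2; here v = d + 2 lambda, whose sign is
    changed by lambda |-> -d - lambda. *)
Lemma skew_bipoly (P : {poly {poly C}}) :
  (forall s t, evs1 s t P = - evs1 s (- s - t) P) ->
  exists Phi : {poly {poly C}}, forall s t,
    evs1 s t P = (s + 2 * t) * evs1 s ((s + 2 * t) ^+ 2) Phi.
Proof.
move=> skew; (* E is P as a polynomial in d and v := d + 2 lambda; it is odd in v. *)
pose E := P \Po ((2^-1)%:P%:P * (l1 C - d1 C)).
have EE s t : evs1 s t E = evs1 s ((t - s) / 2) P.
  by rewrite evs1_comp rmorphM rmorphB evs1_l evs1_d evs1_C hornerC mulrC.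
have Eodd s t : evs1 s (- t) E = - evs1 s t E.
  rewrite !EE skew; congr (- evs1 _ _ _).
  by field.
have dec s t : evs1 s t E =
      evs1 s (t ^+ 2) (even_poly E) + evs1 s (t ^+ 2) (odd_poly E) * t.
  by rewrite -{1}(poly_even_odd E) rmorphD rmorphM !evs1_comp rmorphXn
    [evs1 _ _ 'X]evs1_l.
exists (odd_poly E) => s t.
(* Oddness makes the even part equal to its own negative. *)
have even0 : evs1 s ((s + 2 * t) ^+ 2) (even_poly E) = 0.
  have := Eodd s (s + 2 * t); rewrite !dec sqrrN => H.
  have : 2 * evs1 s ((s + 2 * t) ^+ 2) (even_poly E) = 0.
    by move/eqP: H; rewrite -subr_eq0 => /eqP <-; ring.
  by move/eqP; rewrite mulf_eq0 Num.Theory.pnatr_eq0 => /eqP.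
have -> : evs1 s t P = evs1 s (s + 2 * t) E by rewrite EE; congr (evs1 _ _ _); field.
by rewrite dec even0 add0r mulrC.
Qed.

Lemma R1_iff p : is_R1 p br -> p != 0 ->
  TPCSA (@Rgr C) op br <->
  exists Phi : {poly {poly C}},
    given_by op 0 0 (((d1 C + 2 * l1 C) * (Phi \Po (d1 C + 2 * l1 C) ^+ 2)) *: X).
Proof.
move=> /is_R1_sfun [br0 brp] p0.
have br00 s t : sfun br false false s t = 0 by apply: br0.
have br01 s t : sfun br false true s t = 0 by apply: br0.
have br10 s t : sfun br true false s t = 0 by apply: br0.
have ev_form s t Phi : evs1 s t ((d1 C + 2 * l1 C) * (Phi \Po (d1 C + 2 * l1 C) ^+ 2))
    = (s + 2 * t) * evs1 s ((s + 2 * t) ^+ 2) Phi.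
  by rewrite rmorphM evs1_comp rmorphXn rmorphD rmorphM rmorph_nat evs1_d evs1_l.
rewrite TPCSAP; split=> [[comm _ leib]|[Phi]].
  (* The inner bracket of [y] with [y] is evaluated at d = s + t and contributes p(s + t), nonzero
     as a polynomial in s. The rule on [y], [y], [y] then kills [yx], and on [x], [y], [y] it kills
     [xx]. *)
  have pt t : p \Po ('X + t%:P) != 0 by rewrite comp_poly2_eq0 ?size_XaddC.
  have cancel_p i j t : (forall s, p.[s + t] * sfun op i j s t = 0) ->
      forall s, sfun op i j s t = 0.
    have [q qE] := sfun_poly op i j t.
    move=> pF s; rewrite -qE -(horner0 s); apply: (poly_fun_mulfI (pt t)) => x.
    by rewrite horner_comp !hornerE qE pF.
  have yx0 s t : yx s t = 0.
    move: s; apply: cancel_p => s.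
    have := leib true true true s t 0; rewrite /= !brp !br0 //.
    move/eqP; rewrite !(mul0r, mulr0, addr0) mulf_eq0 Num.Theory.pnatr_eq0.
    by rewrite mulrC => /eqP.
  have xy0 s t : xy s t = 0 by rewrite (comm false true) yx0 mulr0.
  have xx0 s t : xx s t = 0.
    move: s; apply: cancel_p => s.
    have := leib false true true s t 0; rewrite /= !brp !xy0 //.
    move/eqP; rewrite !(mul0r, mulr0, addr0) mulf_eq0 Num.Theory.pnatr_eq0.
    by rewrite mulrC => /eqP.
  have [P yyE] := sfun_bipoly op true true.
  have [s t|Phi PE] := @skew_bipoly P.
    by rewrite -!yyE (comm true true) expr1 mulN1r.
  exists Phi; rewrite (given_byP (P := 0) (Q := 0)) ?scale0r //.
  by split=> s t; rewrite ?xx0 ?xy0 ?yx0 ?rmorph0 // yyE ev_form PE.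
rewrite (given_byP (P := 0) (Q := 0)) ?scale0r // => -[xxE xyE yyE yxE].
have {}xxE s t : xx s t = 0 by rewrite xxE rmorph0.
have {}xyE s t : xy s t = 0 by rewrite xyE rmorph0.
have {}yxE s t : yx s t = 0 by rewrite yxE.
have {}yyE s t := etrans (yyE s t) (ev_form s t Phi).
split.
- case=> -[] s t; rewrite /= ?xxE ?xyE ?yxE ?mulr0 // !yyE.
  have -> : s + 2 * (- s - t) = - (s + 2 * t) by ring.
  by rewrite sqrrN; ring.
(* Every nested expression vanishes: products and brackets have values in the multiples of [x], and
   [x] annihilates everything under both operations. *)
- by case=> -[] -[] s t r; rewrite /= ?xxE ?xyE ?yxE ?(mulr0, mul0r).
- by case=> -[] -[] s t r; rewrite /= ?xxE ?xyE ?yxE ?br00 ?br01 ?br10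
    ?(mulr0, mul0r, addr0).
Qed.

Lemma R1_abelian : is_R1 0 br -> abelian br.
Proof.
move=> /is_R1_sfun [br0 brp]; apply: abelianP => i j s t.
have [/andP[-> ->]|/br0 ->//] := boolP (i && j).
by rewrite brp horner0.
Qed.

(** * The family R_2 *)

Lemma is_R2_sfun q : is_R2 q br ->
  [/\ forall i s t, sfun br i i s t = 0, forall s t, sfun br false true s t = q.[t]
    & forall s t, sfun br true false s t = - q.[- t - s]].
Proof.
have brlp := lie_lp brP => -[_ bxx byy bxy].
have xyE s t : sfun br false true s t = q.[t].
  by rewrite ((sfun_eq brlp false true q^:P).1 bxy) evs1_map.
split=> [i s t| |s t] //; last by rewrite sfun_skew xyE.
case: i; first exact: ((sfun_eq0 brlp true true).1 byy).
exact: ((sfun_eq0 brlp false false).1 bxx).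
Qed.

Lemma R2_abelian : is_R2 0 br -> abelian br.
Proof.
move=> /is_R2_sfun [br0 brxy bryx]; apply: abelianP => i j s t.
by case: i j => -[]; rewrite ?br0 ?brxy ?bryx ?horner0 ?oppr0.
Qed.

Lemma R2_relations q : is_R2 q br -> q != 0 -> sfun_comm op -> sfun_leibniz op br ->
  [/\ forall s t, yy s t = 0, forall s t, xy s t = xy 0 t,
      forall s t r, q.[r] * xy s t = xx (- t - r) t * q.[t + r]
    & forall t r, xy 0 t * q.[r] = xy 0 r * q.[t]].
Proof.
move=> /is_R2_sfun [br0 brxy bryx] q0 comm leib.
have [m qm] := poly_neq0_ex q0.
have xyE s t : xy s t = xy 0 t.
  have [u uE] := sfun_poly op false true t.
  suff [e ue] : exists e, forall x, u.[x] = e by rewrite -!uE !ue.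
  (* The rule on [x], [x], [y] at mu = m, divided by q(m), reads 2 u(d) = e + u(d + m), with this
     [e] free of d. *)
  exists (xx (- (t + m)) t * q.[t + m] / q.[m]).
  apply: (@poly_shift_double _ _ m) => x; apply: (mulIf qm).
  have := leib false false true x t m; rewrite /= !brxy -!uE => E.
  by rewrite [RHS]mulrDl divfK // -mulrA E; ring.
split=> // [s t|s t r|t r].
- have := leib true false true s t m; rewrite /= !br0 !brxy.
  by move/eqP; rewrite !(mul0r, mulr0, addr0) !mulf_eq0 Num.Theory.pnatr_eq0
    (negPf qm) orbF => /eqP.
- have := leib false false true 0 t r; rewrite /= !brxy (xyE (0 + r)) (xyE s) => E.
  have -> : - t - r = - (t + r) by ring.
  apply: (addIr (q.[r] * xy 0 t)); transitivity (2%:R * (xy 0 t * q.[r])); first by ring.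
  by rewrite E; ring.
(* At d = -t - r, lambda = 0, mu = r the bracket of [y] with [x] is -q(t), and the two products [yx]
   become [xy 0 r] and [xy 0 t]. *)
- have := leib true false false (- t - r) 0 r.
  rewrite /= !br0 !bryx !brxy !(comm true false) /= (xyE (- (0 + r))) (xyE (_ + r)).
  rewrite expr0 !mul1r mulr0.
  have -> : - (0 + r) - (- t - r) = t by ring.
  have -> : - - (0 + r) - 0 = r by ring.
  have -> : - (- t - r + r) - 0 = t by ring.
  move=> E; apply/subr0_eq; rewrite -[RHS](mulr0 2) E; ring.
Qed.

Lemma R2_const (k : C) : k != 0 -> is_R2 k%:P br ->
  TPCSA (@Rgr C) op br <-> exists c : C, given_by op (c%:P%:P *: X) (c%:P%:P *: Y) 0.
Proof.
move=> k0 R2; have [br0 brxy bryx] := is_R2_sfun R2.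
rewrite TPCSAP; split=> [[comm assoc leib]|[c /given_by_id [xxE xyE yyE yxE]]].
  have [|yy0 xy0 xxq xyq] := R2_relations R2 _ comm leib; first by rewrite polyC_eq0.
  have xyc s t : xy s t = xy 0 0.
    by rewrite xy0; have := xyq t 0; rewrite !hornerC => /(mulIf k0).
  exists (xy 0 0); apply/given_by_id; split=> // s t; last by rewrite comm mul1r.
  (* mu = -t - s brings the first argument of [xx] to s. *)
  apply: (mulIf k0); have := xxq 0 t (- t - s); rewrite !hornerC xyc.
  have -> : - t - (- t - s) = s by ring.
  by rewrite mulrC.
split.
- by case=> -[] s t; rewrite /= ?xxE ?xyE ?yxE ?yyE ?expr0 ?mul1r ?mulr0.
- by case=> -[] -[] s t r; rewrite /= ?xxE ?xyE ?yxE ?yyE ?(mulr0, mul0r).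
- by case=> -[] -[] s t r; rewrite /= ?xxE ?xyE ?yxE ?yyE ?br0 ?brxy ?bryx ?hornerC
    ?expr0 ?expr1; ring.
Qed.

Lemma R2_nonconst q : (forall k : C, q <> k%:P) -> is_R2 q br ->
  TPCSA (@Rgr C) op br <-> given_by op 0 0 0.
Proof.
move=> qnc R2; split; last exact: TPCSA_zero.
move=> /TPCSAP [comm assoc leib]; apply/given_by0.
have q0 : q != 0 by apply/eqP => q0; apply: (qnc 0); rewrite q0 polyC0.
have [yy0 xy0 xxq xyq] := R2_relations R2 q0 comm leib.
have /closed_rootP [z /rootP qz] : size q != 1%N.
  by apply/negP => /size_poly1P [k _ qk]; apply: (qnc k).
(* Take lambda = z - r and mu = r, so that lambda + mu is the root z. *)
have xyr r : q.[r] * xy 0 (z - r) = 0.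
  by rewrite (xxq 0) subrK qz mulr0.
have xyE s t : xy s t = 0.
  (* A point r with q(r) q(z - r) nonzero suffices: the symmetry [xyq] turns q(r) q(z - r) xy(0, t)
     into q(t) q(r) xy(0, z - r), which is zero. *)
  rewrite xy0; pose w := q * (q \Po (z%:P - 'X)).
  have w0 : w != 0.
    rewrite mulf_neq0 // comp_poly2_eq0 // -opprB size_polyN.
    by rewrite size_XsubC.
  have [r] := poly_neq0_ex w0; rewrite hornerM horner_comp !hornerE => wr.
  apply: (mulfI wr); rewrite mulr0.
  transitivity (q.[r] * (xy 0 t * q.[z - r])); first by ring.
  by rewrite xyq mulrA xyr mul0r.
have xxE s t : xx s t = 0.
  have [u uE] := sfun_poly op false false t.
  rewrite -uE -(horner0 s); apply: (@poly_fun_mulfI _ (q \Po (- 'X))).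
    by rewrite comp_poly2_eq0 // size_polyN size_polyX.
  move=> x; rewrite horner_comp !hornerE uE mulrC.
  have := xxq 0 t (- t - x); rewrite xyE mulr0.
  have -> : - t - (- t - x) = x by ring.
  by have -> : t + (- t - x) = - x by ring.
by case=> -[] s t //; rewrite comm xyE mulr0.
Qed.

(** * The families R_3, R_4 and R_5, where [x] generates a Virasoro algebra *)

Lemma Virasoro_xx : (forall s t, sfun br false false s t = s + 2 * t) ->
  sfun_comm op -> sfun_leibniz op br -> forall s t, xx s t = xx 0 0.
Proof.
move=> brxx comm leib.
(* At mu = 0 the rule on [x], [x], [x] becomes (s + 2t) xx(s, t) = (s + 2t) xx(-t, t), so [xx] is
   free of d. *)
have xxE s t : xx s t = xx (- t) t.
  have [u uE] := sfun_poly op false false t.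
  rewrite -uE -(hornerC (xx (- t) t) s).
  apply: (@poly_fun_mulfI _ ('X + (2 * t)%:P));
  first by rewrite -size_poly_eq0 size_XaddC.
  move=> x; rewrite !hornerE uE.
  have := leib false false false x t 0; rewrite /= !brxx !addr0 => E.
  apply: (addIr (x * xx x t)); transitivity (2 * (xx x t * (x + t))); first by ring.
  move: E; rewrite !mulr0 !addr0 => ->; ring.
(* Commutativity replaces lambda by -d - lambda, which is 0 at d = -lambda. *)
move=> s t; rewrite xxE (comm false false) mul1r xxE.
have -> : - - t - t = 0 by ring.
by rewrite oppr0.
Qed.

(** At mu = 0 the rule on [y], [x], [y] becomes (s + 2t + 2c) yy(s, t) = 0 once the last hypothesis
    removes the term with the bracket of [y] with [y]. *)
Lemma Virasoro_yy b c : (forall s t, sfun br false false s t = s + 2 * t) ->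
  (forall s t, sfun br false true s t = s + b * t + c) ->
  sfun_leibniz op br -> (forall s t x u, sfun br true true s t * yx x u = 0) ->
  forall s t, yy s t = 0.
Proof.
move=> brxx brxy leib bryx0 s t.
have [u uE] := sfun_poly op true true t.
rewrite -uE -(horner0 s).
apply: (@poly_fun_mulfI _ ('X + (2 * (t + c))%:P));
  first by rewrite -size_poly_eq0 size_XaddC.
move=> x; rewrite !hornerE uE.
have := leib true false true x t 0; rewrite /= !brxx !brxy bryx0.
rewrite !(mulr0, addr0, add0r) mul1r => E.
apply: (addIr (x * yy x t)); transitivity (2 * (yy x t * (x + t + c))); first by ring.
by rewrite E; ring.
Qed.

Lemma Virasoro_xy b c : (forall s t, sfun br false false s t = s + 2 * t) ->
  (forall s t, sfun br false true s t = s + b * t + c) ->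
  sfun_comm op -> sfun_leibniz op br ->
  (forall s t, xy s t = xx 0 0) /\ (b <> 2 -> xx 0 0 = 0).
Proof.
move=> brxx brxy comm leib; have xxE := Virasoro_xx brxx comm leib.
have key s t : (s + 2 * t + c) * xy s t = xx 0 0 * (s + b * t + c).
  have := leib false false true s t 0.
  rewrite /= !brxy !xxE !(mulr0, addr0) expr0 mul1r => E.
  apply: (addIr ((s + c) * xy s t)); transitivity (2 * (xy s t * (s + t + c))).
    by ring.
  by rewrite E; ring.
have b2 : (b - 2) * xx 0 0 = 0.
  (* A zero of the left factor s + 2t + c, where the factor on the right equals b - 2. *)
  have := key (- (2 + c)) 1.
  have -> : - (2 + c) + 2 * 1 + c = 0 by ring.
  by rewrite mul0r => E; rewrite [RHS]E; ring.
split=> [s t|/eqP]; last first.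
  by rewrite -subr_eq0 => /negPf b0; move/eqP: b2; rewrite mulf_eq0 b0 => /eqP.
have [u uE] := sfun_poly op false true t.
rewrite -uE -(hornerC (xx 0 0) s).
apply: (@poly_fun_mulfI _ ('X + (2 * t + c)%:P));
  first by rewrite -size_poly_eq0 size_XaddC.
move=> x; rewrite !hornerE uE /= key.
transitivity ((x + 2 * t + c) * xx 0 0 + t * ((b - 2) * xx 0 0)); first by ring.
by rewrite b2 mulr0 addr0.
Qed.

(** Here [x] and [y] have zero bracket, outside the reach of [Virasoro_xy] and [Virasoro_yy]. At mu
    = 0 the rule gives directly (s + t) yx = 0, and then s yy = 0. *)
Lemma R3_iff : is_R3 br ->
  TPCSA (@Rgr C) op br <-> exists c : C, given_by op (c%:P%:P *: X) 0 0.
Proof.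
have brlp := lie_lp brP => -[_ bxx bxy byy].
have brxx s t : sfun br false false s t = s + 2 * t.
  rewrite ((sfun_eq brlp false false _).1 bxx).
  by rewrite rmorphD rmorphM rmorph_nat evs1_d evs1_l.
have brxy := (sfun_eq0 brlp false true).1 bxy.
have bryy := (sfun_eq0 brlp true true).1 byy.
have bryx s t : sfun br true false s t = 0 by rewrite sfun_skew brxy oppr0.
rewrite TPCSAP; split=> [[comm _ leib]|[c /given_by_x [xxE xyE yyE yxE]]].
  have yx0 s t : yx s t = 0.
    have [u uE] := sfun_poly op true false t.
    rewrite -uE -(horner0 s).
    apply: (@poly_fun_mulfI _ ('X + t%:P));
  first by rewrite -size_poly_eq0 size_XaddC.
    move=> x; rewrite !hornerE uE.
    have := leib true false false x t 0; rewrite /= !brxx brxy bryx.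
    rewrite !(mulr0, mul0r, addr0).
    by move/eqP; rewrite mulf_eq0 Num.Theory.pnatr_eq0 mulrC => /eqP.
  have yy0 s t : yy s t = 0.
    have [u uE] := sfun_poly op true true t.
    rewrite -uE -(horner0 s).
    apply: (@poly_fun_mulfI _ 'X); first by rewrite polyX_eq0.
    move=> x; rewrite !hornerE uE.
    have := leib true false true x t 0; rewrite /= brxx !brxy yx0.
    rewrite !(mulr0, mul0r, addr0, add0r, mul1r).
    by move=> <-.
  exists (xx 0 0); apply/given_by_x; split=> // s t; first exact: Virasoro_xx.
  by rewrite comm yx0 mulr0.
split.
- by case=> -[] s t; rewrite /= ?xxE ?xyE ?yxE ?yyE ?expr0 ?mul1r ?mulr0.
- by case=> -[] -[] s t r; rewrite /= ?xxE ?xyE ?yxE ?yyE ?(mulr0, mul0r).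
- by case=> -[] -[] s t r; rewrite /= ?xxE ?xyE ?yxE ?yyE ?bryy ?brxy ?bryx ?brxx
    ?expr0 ?expr1; ring.
Qed.

(** [xx], [xy] and [yx] vanish first, so the hypothesis of [Virasoro_yy] on the bracket of [y] with
    [y] holds through [yx]. This serves both R_4 with beta other than 2 and R_5. *)
Lemma Virasoro_trivial (b c : C) :
  (forall s t, sfun br false false s t = s + 2 * t) ->
  (forall s t, sfun br false true s t = s + b * t + c) -> b <> 2 ->
  TPCSA (@Rgr C) op br <-> given_by op 0 0 0.
Proof.
move=> brxx brxy b2; split; last exact: TPCSA_zero.
move=> /TPCSAP [comm _ leib]; apply/given_by0.
have [xyE /(_ b2) xx00] := Virasoro_xy brxx brxy comm leib.
have xx0 s t : xx s t = 0 by rewrite (Virasoro_xx brxx comm leib).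
have yx0 s t : yx s t = 0 by rewrite comm xyE xx00 mulr0.
by case=> -[] s t //; rewrite ?xyE // (Virasoro_yy brxx brxy leib) // => *;
  rewrite yx0 mulr0.
Qed.

Lemma is_R4_sfun b c : is_R4 b c br ->
  [/\ forall s t, sfun br false false s t = s + 2 * t,
      forall s t, sfun br false true s t = s + b * t + c
    & forall s t, sfun br true true s t = 0].
Proof.
have brlp := lie_lp brP => -[_ bxx bxy byy]; split=> [s t|s t|].
- rewrite ((sfun_eq brlp false false _).1 bxx).
  by rewrite rmorphD rmorphM rmorph_nat evs1_d evs1_l.
- rewrite ((sfun_eq brlp false true _).1 bxy).
  by rewrite !rmorphD rmorphM evs1_d evs1_l !evs1_C !hornerC.
- exact: ((sfun_eq0 brlp true true).1 byy).
Qed.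

Lemma R4_weight2 c : is_R4 2 c br ->
  TPCSA (@Rgr C) op br <-> exists c : C, given_by op (c%:P%:P *: X) (c%:P%:P *: Y) 0.
Proof.
move=> /is_R4_sfun [brxx brxy bryy].
rewrite TPCSAP; split=> [[comm _ leib]|[k /given_by_id [xxE xyE yyE yxE]]].
  have [xy0 _] := Virasoro_xy brxx brxy comm leib.
  have xx0 := Virasoro_xx brxx comm leib.
  exists (xx 0 0); apply/given_by_id; split=> // s t; last by rewrite comm mul1r.
  by apply: (Virasoro_yy brxx brxy leib) => *; rewrite bryy mul0r.
have bryx s t : sfun br true false s t = s + 2 * t - c.
  by rewrite sfun_skew brxy; ring.
split.
- by case=> -[] s t; rewrite /= ?xxE ?xyE ?yxE ?yyE ?expr0 ?mul1r ?mulr0.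
- by case=> -[] -[] s t r; rewrite /= ?xxE ?xyE ?yxE ?yyE ?(mulr0, mul0r).
- by case=> -[] -[] s t r; rewrite /= ?xxE ?xyE ?yxE ?yyE ?bryy ?brxy ?bryx ?brxx
    ?expr0 ?expr1; ring.
Qed.

Lemma R4_other b c : b <> 2 -> is_R4 b c br ->
  TPCSA (@Rgr C) op br <-> given_by op 0 0 0.
Proof. by move=> b2 /is_R4_sfun [brxx brxy _]; apply: Virasoro_trivial brxy b2. Qed.

Lemma R5_iff a : is_R5 a br -> TPCSA (@Rgr C) op br <-> given_by op 0 0 0.
Proof.
have brlp := lie_lp brP => -[_ bxx bxy _].
apply: (@Virasoro_trivial (3 / 2) 0) => [s t|s t|/eqP].
- rewrite ((sfun_eq brlp false false _).1 bxx).
  by rewrite rmorphD rmorphM rmorph_nat evs1_d evs1_l.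
- rewrite ((sfun_eq brlp false true _).1 bxy).
  by rewrite rmorphD rmorphM evs1_d evs1_l !evs1_C !hornerC addr0.
- by rewrite -subr_eq0 (_ : 3 / 2 - 2 = - 2^-1 :> C) ?oppr_eq0 ?invr_eq0
    ?Num.Theory.pnatr_eq0 //; field.
Qed.

End Classification.

Theorem theorem5p2 (K : realType) (op br : Rmod K[i] -> Rmod K[i] -> lpoly (Rmod K[i]))
    (hop : even_lambda_product (@Rgr K[i]) op) :
  [/\ (forall p : {poly K[i]}, is_R1 p br ->
         (p != 0 ->
            (TPCSA (@Rgr K[i]) op br <->
             exists Phi : {poly {poly K[i]}},
               given_by op 0 0
                 (((d1 K[i] + 2 * l1 K[i])
                     * (Phi \Po (d1 K[i] + 2 * l1 K[i]) ^+ 2))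
                    *: lconst (gx K[i]))))
         /\ (p = 0 ->
               abelian br /\
               (TPCSA (@Rgr K[i]) op br <->
                lp_commutative (@Rgr K[i]) op /\ lp_associative op))),
      (forall q : {poly K[i]}, is_R2 q br ->
         [/\ q = 0 ->
               abelian br /\
               (TPCSA (@Rgr K[i]) op br <->
                lp_commutative (@Rgr K[i]) op /\ lp_associative op),
             (exists2 k : K[i], k != 0 & q = k%:P) ->
               (TPCSA (@Rgr K[i]) op br <->
                exists c : K[i],
                  given_by op (c%:P%:P *: lconst (gx K[i]))
                    (c%:P%:P *: lconst (gy K[i])) 0)
           & (forall k : K[i], q <> k%:P) ->
               (TPCSA (@Rgr K[i]) op br <-> given_by op 0 0 0)]),
      (is_R3 br ->
         (TPCSA (@Rgr K[i]) op br <->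
          exists c : K[i], given_by op (c%:P%:P *: lconst (gx K[i])) 0 0)),
      (forall beta gamma : K[i], is_R4 beta gamma br ->
         (beta = 2 ->
            (TPCSA (@Rgr K[i]) op br <->
             exists c : K[i],
               given_by op (c%:P%:P *: lconst (gx K[i]))
                 (c%:P%:P *: lconst (gy K[i])) 0))
         /\ (beta <> 2 ->
               (TPCSA (@Rgr K[i]) op br <-> given_by op 0 0 0)))
    & (forall alpha : K[i], is_R5 alpha br ->
         (TPCSA (@Rgr K[i]) op br <-> given_by op 0 0 0))].
Proof.
split.
- move=> p R1; have lieP : Lie_conformal_superalgebra (@Rgr K[i]) br by case: R1.
  split=> [|p0]; first exact: R1_iff.
  move: R1; rewrite p0 => /(R1_abelian lieP) ab.
  by split=> //; apply: TPCSA_abelian.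
- move=> q R2; have lieP : Lie_conformal_superalgebra (@Rgr K[i]) br by case: R2.
  split=> [q0|[k k0 qk]|qnc].
  + move: R2; rewrite q0 => /(R2_abelian lieP) ab.
    by split=> //; apply: TPCSA_abelian.
  + by move: R2; rewrite qk; apply: R2_const.
  + exact: R2_nonconst R2.
- move=> R3; have lieP : Lie_conformal_superalgebra (@Rgr K[i]) br by case: R3.
  exact: R3_iff.
- move=> beta gamma R4; have lieP : Lie_conformal_superalgebra (@Rgr K[i]) br by case: R4.
  split=> b; last exact: R4_other R4.
  by move: R4; rewrite b; apply: R4_weight2.
- move=> alpha R5; have lieP : Lie_conformal_superalgebra (@Rgr K[i]) br by case: R5.
  exact: R5_iff R5.
Qed.
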